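(* Let $c(K)$ and $c(L)$ be two (distinct) circles in the Euclidean plane with respective centers $K$ and $L$. Let $n>2$ be an even number, and let $P_1,\ldots,P_n$ be (distinct) points on $c(K)$ and $Q_1,\ldots,Q_n$ (distinct) points on $c(L)$, such that for each $i=1,\ldots,n$ the quadruple $P_iQ_iQ_{i+1}P_{i+1}$ is cyclic, where indices are taken modulo $n$ (so $P_{n+1}=P_1$ and $Q_{n+1}=Q_1$). For each $i$ let $O_i$ denote the center of the circle $c(O_i)$ circumscribed about the quadrangle $P_iQ_iQ_{i+1}P_{i+1}$ (and $O_{n+1}=O_1$). Then there is a fixed conic with foci $K$ and $L$, not depending on $i$, such that for each $i=1,\ldots,n$ the line $O_iO_{i+1}$ is tangent to this conic.
   Context: The setting is the Euclidean plane. $c(X)$ denotes a circle with center $X$. A quadruple of points is cyclic if it consists of four distinct points lying on a common circle; that circle is the circle circumscribed about the quadrangle they form. If $K=L$, a conic with foci $K$ and $L$ is a circle centered at $K$.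
   Formalization: The conic may be the degenerate hyperbola, i.e. the perpendicular bisector of KL (needed when the circles are congruent and each Q_i mirrors P_i, so all lines O_iO_{i+1} are that bisector), and an asymptote of a hyperbola counts as a tangent line. *)

(* Defs.v *)
From mathcomp Require Export all_boot all_order all_algebra.
From mathcomp Require Export classical_sets reals.

Set Implicit Arguments.
Unset Strict Implicit.
Unset Printing Implicit Defensive.

Import Order.TTheory GRing.Theory Num.Theory.
Local Open Scope ring_scope.
Local Open Scope classical_set_scope.

Section EuclideanPlane.
Variable R : realType.
Implicit Types (A B C D K L O X : 'rV[R]_2) (M : 'M[R]_3) (u v : 'rV[R]_3).

(* The norm that the library puts on row vectors is the sup norm, hence an
   explicit Euclidean distance. *)
Definition edist A B : R :=
  Num.sqrt (\sum_(j < 2) (A ord0 j - B ord0 j) ^+ 2).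

Definition circle O (r : R) : set 'rV[R]_2 := [set X | edist X O = r].

Definition on_circle4 O (r : R) A B C D : Prop :=
  0 < r /\ [set A; B; C; D] `<=` circle O r.

Definition cyclic4 A B C D : Prop :=
  uniq [:: A; B; C; D] /\ exists O r, on_circle4 O r A B C D.

Definition is_circumcenter O A B C D : Prop := exists r, on_circle4 O r A B C D.

(* Homogeneous coordinates (x : y : 1) of the point (x, y). *)
Definition homog X : 'rV[R]_3 := row_mx X (1%:M : 'M[R]_1).

Definition qform M u v : R := (u *m M *m v^T) ord0 ord0.

(* A projective conic is given by the matrix of its equation.  A singular
   matrix is allowed; see [conic_with_foci]. *)
Definition is_conic M : Prop := M^T = M /\ M <> 0.

Definition affine_locus M : set 'rV[R]_2 :=
  [set X | qform M (homog X) (homog X) = 0].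

(* The points at distances with sum 2a > |KL| (an ellipse, or a circle centered
   at K if K = L), or with difference 2a < |KL| (a hyperbola).  The value a = 0
   in the second case is the degenerate hyperbola, whose locus is the
   perpendicular bisector of KL. *)
Definition conic_with_foci M K L : Prop :=
  is_conic M /\
  exists a : R, 0 <= a /\
    ((edist K L < 2 * a /\
      affine_locus M = [set X | edist X K + edist X L = 2 * a]) \/
     (2 * a < edist K L /\
      affine_locus M = [set X | `|edist X K - edist X L| = 2 * a])).

(* The line AB is the tangent {w | v M w^T = 0} of the conic at some nonsingular
   real point v of the projective plane.  The point v may be at infinity, so
   that the asymptotes of a hyperbola are tangents.  If the affine locus of M is
   a line (a = 0 in [conic_with_foci]), M is either the square of that line,
   which has no nonsingular point, or the product of that line with the line at
   infinity; hence AB can be tangent only if it is that line itself. *)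
Definition line_tangent_to_conic M A B : Prop :=
  A <> B /\
  exists v, [/\ v *m M <> 0, qform M v v = 0,
                qform M v (homog A) = 0 & qform M v (homog B) = 0].

End EuclideanPlane.

(* Main.v *)
Require Import Defs.
From mathcomp Require Import all_boot all_order all_algebra.
From mathcomp Require Import classical_sets reals.
From mathcomp Require Import boolp ring lra.
Import Order.TTheory GRing.Theory Num.Theory.
Local Open Scope ring_scope.
Set Implicit Arguments.
Unset Strict Implicit.
Unset Printing Implicit Defensive.

(** The line [O_(i-1) O_i] joins two points that are equidistant from [P_i] and
    [Q_i], so it is the perpendicular bisector of [P_i Q_i].  A line is tangent
    to a conic with foci [K], [L] and axis [2a] exactly when the mirror image
    of [K] in it lies at distance [2a] from [L].  Hence everything comes down to
    showing that the distance from [L] to the mirror image [K_i] of [K] in the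
    bisector of [P_i Q_i] does not depend on [i].

    Write [pow_K], [pow_L] for the powers of a point with respect to [c(K)] and
    [c(L)].  Computing the reflection gives ([sqd_mirror])
      [|K_i L|^2 = |KL|^2 - pow_K(Q_i) pow_L(P_i) / |P_i Q_i|^2].
    The difference between the powers with respect to [c(K)] and [c(O_i)] is an
    affine function that vanishes on their common chord [P_i P_(i+1)]; so at
    points of [c(O_i)] the power with respect to [c(K)] is a fixed multiple of
    the area of the triangle on that chord ([power_difference]), and likewise
    for [c(L)] and the chord [Q_i Q_(i+1)].  Expressing areas of triangles
    inscribed in [c(O_i)] through their sides shows that the quotient above takes
    the same value at [i] and at [i+1] ([concyclic_chords],
    [mirror_focus_invariant]).

    It remains to exclude degeneracies.  All of them follow from the fact that
    two circles with three common points coincide ([three_common_points]).  If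
    [P_i] were on [c(L)], then [c(O_i)] and [c(L)] would share [P_i], [Q_i],
    [Q_(i+1)], so [P_(i+1)] would be on [c(L)] too, and continuing gives three
    common points of [c(K)] and [c(L)] ([no_common_vertex]).  Therefore the powers
    never vanish, that is [2a <> |KL|], and the conic is a genuine ellipse,
    circle or hyperbola, or the bisector of [KL] if [a = 0].  If [O_i] and
    [O_(i+1)] were equal, then [c(O_i)] would contain three of the [P_j] and three
    of the [Q_j], so it would be both [c(K)] and [c(L)]. *)

(** * Squared distances and areas *)

Notation px A := (A ord0 (0 : 'I_2)).
Notation py A := (A ord0 (1 : 'I_2)).

Section Plane.
Variable R : realType.
Implicit Types A B C K L O P Q X : 'rV[R]_2.

Definition sqd A B : R := (px A - px B) ^+ 2 + (py A - py B) ^+ 2.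

(** Twice the signed area of a triangle. *)
Definition area2 A B C : R :=
  (px B - px A) * (py C - py A) - (py B - py A) * (px C - px A).

Lemma edistE A B : edist A B = Num.sqrt (sqd A B).
Proof.
rewrite /edist /sqd !big_ord_recl big_ord0 addr0.
by rewrite (_ : lift ord0 ord0 = 1) //; apply: val_inj.
Qed.

Lemma sqd_ge0 A B : 0 <= sqd A B.
Proof. by rewrite addr_ge0 ?sqr_ge0. Qed.

Lemma sqdC A B : sqd A B = sqd B A.
Proof. by rewrite /sqd; ring. Qed.

Lemma sqd_eq0 A B : (sqd A B == 0) = (A == B).
Proof.
apply/eqP/eqP => [|->]; last by rewrite /sqd; ring.
move/eqP; rewrite paddr_eq0 ?sqr_ge0 // !sqrf_eq0 !subr_eq0 => /andP[/eqP e0 /eqP e1].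
apply/rowP => j; have [->//|->//] : j = 0 \/ j = 1.
by case: j => [[|[|m]] hm] //; [left|right]; apply: val_inj.
Qed.

Lemma circle_sqd O (r : R) X : 0 < r -> circle O r X <-> sqd X O = r ^+ 2.
Proof.
move=> r0; rewrite /circle /= edistE; split=> [<-|->].
  by rewrite sqr_sqrtr ?sqd_ge0.
by rewrite sqrtr_sqr ger0_norm // ltW.
Qed.

Lemma area2_sub O A B C : area2 (A - O) (B - O) (C - O) = area2 A B C.
Proof. by rewrite /area2 !mxE; ring. Qed.

Lemma sqd_sub O A B : sqd (A - O) (B - O) = sqd A B.
Proof. by rewrite /sqd !mxE; ring. Qed.

Lemma sqd_sub0 O A : sqd A O = px (A - O) ^+ 2 + py (A - O) ^+ 2.
Proof. by rewrite /sqd !mxE. Qed.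

(** * Circles through common points *)

(** The left-hand side is the difference between the powers of [X] with respect
    to the circles centered at [K] and [O] through [P].  It is affine in [X] and
    vanishes on the line [P P'], as the area of [X P P'] does. *)
Lemma power_difference K O P P' :
  P != P' -> sqd P K = sqd P' K -> sqd P O = sqd P' O ->
  exists k, forall X,
    (sqd X K - sqd P K) - (sqd X O - sqd P O) = k * area2 X P P'.
Proof.
rewrite -sqd_eq0 => d0 hK hO.
pose c := (px O - px K) * (py P' - py P) - (py O - py K) * (px P' - px P).
pose h := (px O - px K) * (px P' - px P) + (py O - py K) * (py P' - py P).
have h0 : h = 0 by move: hK hO; rewrite /h /sqd; lra.
(* Since [KO] is orthogonal to [P P'] by [h0], it is determined by [c]. *)
exists (- 2 * c / sqd P P') => X.
apply: (mulIf d0); rewrite mulrAC divfK //.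
apply/eqP; rewrite -subr_eq0; apply/eqP.
transitivity (2 * h * ((px X - px P) * (px P' - px P)
                       + (py X - py P) * (py P' - py P))).
  by rewrite /h /c /sqd /area2; ring.
by rewrite h0; ring.
Qed.

(** The formula [abc / 4R] for the area, squared: it shows that three distinct
    points of a circle are not collinear. *)
Lemma circumradius_area O A B C : sqd A O = sqd B O -> sqd A O = sqd C O ->
  4 * sqd A O * area2 A B C ^+ 2 = sqd A B * sqd B C * sqd C A.
Proof.
rewrite -(area2_sub O) -(sqd_sub O A B) -(sqd_sub O B C) -(sqd_sub O C A).
rewrite !(sqd_sub0 O); move: (A - O) (B - O) (C - O) => {}A {}B {}C.
rewrite /sqd /area2 => hB hC.
have {}hB : py B ^+ 2 = px A ^+ 2 + py A ^+ 2 - px B ^+ 2 by lra.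
have {}hC : py C ^+ 2 = px A ^+ 2 + py A ^+ 2 - px C ^+ 2 by lra.
ring: hB hC.
Qed.

(** By the formula [abc / 4R], the two triangles on the left and the two on the
    right have the product of areas [|PQ|^2], respectively [|P'Q'|^2], times the
    same product of the four other chords.  The signs agree because, on a circle,
    [Q] and [Q'] are on the same side of [P P'] if and only if [P] and [P'] are on
    the same side of [Q Q']. *)
Lemma concyclic_chords O P P' Q Q' :
  sqd P O = sqd P' O -> sqd P O = sqd Q O -> sqd P O = sqd Q' O ->
  area2 Q P P' * area2 P Q Q' * sqd P' Q'
  = area2 Q' P P' * area2 P' Q Q' * sqd P Q.
Proof.
rewrite -(area2_sub O Q P P') -(area2_sub O P Q Q') -(area2_sub O Q' P P').
rewrite -(area2_sub O P' Q Q') -(sqd_sub O P' Q') -(sqd_sub O P Q) !(sqd_sub0 O).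
move: (P - O) (P' - O) (Q - O) (Q' - O) => {}P {}P' {}Q {}Q'.
rewrite /sqd /area2 => hP' hQ hQ'.
have {}hP' : py P' ^+ 2 = px P ^+ 2 + py P ^+ 2 - px P' ^+ 2 by lra.
have {}hQ : py Q ^+ 2 = px P ^+ 2 + py P ^+ 2 - px Q ^+ 2 by lra.
have {}hQ' : py Q' ^+ 2 = px P ^+ 2 + py P ^+ 2 - px Q' ^+ 2 by lra.
ring: hP' hQ hQ'.
Qed.

(** Two circles with three common points assign the same power to every point,
    so they coincide. *)
Lemma three_common_points K O A B C X :
  A != B -> B != C -> C != A ->
  sqd A K = sqd B K -> sqd A K = sqd C K ->
  sqd A O = sqd B O -> sqd A O = sqd C O ->
  sqd X K - sqd A K = sqd X O - sqd A O.
Proof.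
move=> AB BC CA KB KC OB OC.
have [k hk] := power_difference AB KB OB.
have : area2 C A B != 0.
  apply/eqP => a0; have := circumradius_area (esym KC) (etrans (esym KC) KB).
  by rewrite a0 expr0n mulr0 => /esym/eqP; rewrite !mulf_eq0 !sqd_eq0
    (negPf AB) (negPf BC) (negPf CA).
have := hk C; rewrite KC OC !subrr => /esym/eqP; rewrite mulf_eq0.
move=> /orP[/eqP k0 _|-> //].
by have := hk X; rewrite k0 mul0r KC OC => /eqP; rewrite subr_eq0 => /eqP.
Qed.

(** * The mirror image of a focus *)

(** The reflection in the perpendicular bisector of [PQ]. *)
Definition mirror P Q X : 'rV[R]_2 :=
  X - ((sqd X P - sqd X Q) / sqd P Q) *: (Q - P).

Lemma sqd_mirror_equidistant P Q X A : P != Q -> sqd A P = sqd A Q ->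
  sqd A (mirror P Q X) = sqd A X.
Proof.
rewrite -sqd_eq0 => d0 hA; set k := (sqd X P - sqd X Q) / sqd P Q.
have hk : k * sqd P Q = sqd X P - sqd X Q by rewrite divfK.
have -> : sqd A (mirror P Q X) = sqd A X +
    k * (k * sqd P Q - (sqd X P - sqd X Q) + (sqd A P - sqd A Q)).
  by rewrite /mirror -/k /sqd !mxE; ring.
by rewrite hk hA !subrr addr0 mulr0 addr0.
Qed.

(** The factors on the right are [2 |PQ|] times the signed distances of [X] and
    [Y] to the mirror, so [|X'Y|^2 - |XY|^2] is four times the product of these
    distances. *)
Lemma sqd_mirror P Q X Y : P != Q ->
  (sqd (mirror P Q X) Y - sqd X Y) * sqd P Q
  = (sqd X P - sqd X Q) * (sqd Y P - sqd Y Q).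
Proof.
rewrite -sqd_eq0 => d0; set k := (sqd X P - sqd X Q) / sqd P Q.
have hk : k * sqd P Q = sqd X P - sqd X Q by rewrite divfK.
rewrite -hk [RHS]mulrAC; congr (_ * _).
have -> : sqd (mirror P Q X) Y - sqd X Y =
    k * (k * sqd P Q - (sqd X P - sqd X Q) + (sqd Y P - sqd Y Q)).
  by rewrite /mirror -/k /sqd !mxE; ring.
by rewrite hk subrr add0r.
Qed.

(** By [sqd_mirror] the claim is that [pow_K(Q) pow_L(P) / |PQ|^2] is unchanged
    when [P], [Q] become [P'], [Q'].  On the circle [c(O)], the factor [pow_K] is
    proportional to the area over the chord [P P'] and [pow_L] to the area over
    the chord [Q Q']. *)
Lemma mirror_focus_invariant K L O P P' Q Q' :
  P != P' -> Q != Q' -> P != Q -> P' != Q' ->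
  sqd P K = sqd P' K -> sqd Q L = sqd Q' L ->
  sqd P O = sqd P' O -> sqd P O = sqd Q O -> sqd P O = sqd Q' O ->
  sqd (mirror P Q K) L = sqd (mirror P' Q' K) L.
Proof.
move=> PP' QQ' PQ PQ' hK hL OP' OQ OQ'.
have [k hk] := power_difference PP' hK OP'.
have [l hl] := power_difference QQ' hL (etrans (esym OQ) OQ').
have := hk Q; have := hk Q'; have := hl P; have := hl P'.
rewrite -OP' -OQ -OQ' !subrr !subr0 => lP' lP kQ' kQ.
have d0 : sqd P Q != 0 by rewrite sqd_eq0.
have d0' : sqd P' Q' != 0 by rewrite sqd_eq0.
apply: (addIr (- sqd K L)); apply: (mulIf d0); apply: (mulIf d0').
rewrite [RHS]mulrAC !sqd_mirror // !(sqdC K) !(sqdC L).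
rewrite -hK -hL.
rewrite -(opprB (sqd Q K)) -(opprB (sqd Q' K)) kQ kQ' lP lP'.
have := concyclic_chords OP' OQ OQ'.
move: (sqd P Q) (sqd P' Q') => d d' h.
transitivity (- k * l * (area2 Q P P' * area2 P Q Q' * d')); first ring.
by rewrite h; ring.
Qed.

(** * Coordinates of the projective plane *)

Definition sym3 a b c d e f : 'M[R]_3 := \matrix_(i, j)
  nth 0 (nth [::] [:: [:: a; b; c]; [:: b; d; e]; [:: c; e; f]] i) j.

Lemma sym3_tr a b c d e f : (sym3 a b c d e f)^T = sym3 a b c d e f.
Proof.
by apply/matrixP => -[[|[|[|i]]] hi] // [[|[|[|j]]] hj] //; rewrite !mxE.
Qed.

Definition row3 a b c : 'rV[R]_3 := \row_j nth 0 [:: a; b; c] j.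

Lemma row3_neq0 a b c : [|| a != 0, b != 0 | c != 0] -> row3 a b c != 0.
Proof.
apply: contraTneq => /rowP h.
have := h 0; have := h 1; have := h 2.
by rewrite !mxE /= => -> -> ->; rewrite eqxx.
Qed.

Lemma homogE A : homog A = row3 (px A) (py A) 1.
Proof.
apply/rowP => j; rewrite /homog !mxE.
case: splitP => [[[|[|k]] hk]|[[|k] hk]] //= ->; rewrite ?mxE //=;
  congr (A _ _); exact: val_inj.
Qed.

Lemma sum3 (F : 'I_3 -> R) : \sum_j F j = F 0 + F 1 + F 2.
Proof.
rewrite !big_ord_recl big_ord0 addr0 addrA; congr (_ + F _ + F _); exact: val_inj.
Qed.

Lemma row3_sym3 x y z a b c d e f : row3 x y z *m sym3 a b c d e f =
  row3 (x * a + y * b + z * c) (x * b + y * d + z * e) (x * c + y * e + z * f).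
Proof. by apply/rowP => -[[|[|[|j]]] hj] //; rewrite !mxE sum3 !mxE. Qed.

Lemma row3_dot a b c x y z :
  (row3 a b c *m (row3 x y z)^T) ord0 ord0 = a * x + b * y + c * z.
Proof. by rewrite !mxE sum3 !mxE. Qed.

(** * The conic with given foci *)

(** The conic with foci [K], [L] and [D = (2a)^2].  Squaring away the roots in
    [|XK| + |XL| = 2a] or [|XK| - |XL| = 2a] gives
    [D^2 - 2 D (|XK|^2 + |XL|^2) + (|XK|^2 - |XL|^2)^2 = 0]; a quarter of this is
    [(e . x)^2 - D |x|^2 + D (D - |KL|^2) / 4 = 0] with [e = L - K] and [x] the
    position relative to the midpoint of [KL].  For [D = 0] this is the square of
    the bisector of [KL], all of whose points are singular; the product of the
    bisector and the line at infinity has the same affine points, with the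
    bisector as its tangent there. *)
Definition focal_conic K L D : 'M[R]_3 :=
  let ex := px L - px K in let ey := py L - py K in
  let mx := (px K + px L) / 2 in let my := (py K + py L) / 2 in
  let a := ex ^+ 2 - D in let b := ex * ey in let d := ey ^+ 2 - D in
  if D == 0 then sym3 0 0 ex 0 ey (- 2 * (ex * mx + ey * my)) else
  sym3 a b (- (a * mx + b * my)) d (- (b * mx + d * my))
   (a * mx ^+ 2 + 2 * b * mx * my + d * my ^+ 2 + D * (D - sqd K L) / 4).

Lemma focal_conic0E K L X Y :
  qform (focal_conic K L 0) (homog X) (homog Y)
   = (sqd X K - sqd X L + (sqd Y K - sqd Y L)) / 2.
Proof.
by rewrite /qform /focal_conic eqxx !homogE row3_sym3 row3_dot /sqd; field.
Qed.

Lemma focal_conicE K L D X : D != 0 ->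
  4 * qform (focal_conic K L D) (homog X) (homog X)
   = D ^+ 2 - 2 * D * (sqd X K + sqd X L) + (sqd X K - sqd X L) ^+ 2.
Proof.
move=> /negPf D0; rewrite /qform /focal_conic D0 !homogE row3_sym3 row3_dot /sqd.
by field.
Qed.

Lemma focal_conic_is_conic K L D :
  D != sqd K L -> is_conic (focal_conic K L D).
Proof.
move=> DE; split; first by rewrite /focal_conic; case: ifP => _; exact: sym3_tr.
move=> M0.
have q0 u : qform (focal_conic K L D) u u = 0 by rewrite /qform M0 mulmx0 mul0mx mxE.
have [D0|D0] := eqVneq D 0.
  move: (q0 (homog K)) DE; rewrite D0 focal_conic0E.
  rewrite (_ : sqd K K = 0); last by rewrite /sqd; ring.
  by move=> h; rewrite (_ : sqd K L = 0) ?eqxx //; lra.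
(* The center of the conic is not on it. *)
have /esym/eqP := focal_conicE K L (2^-1 *: (K + L)) D0.
rewrite q0 mulr0 (_ : _ + _ = D * (D - sqd K L)); last first.
  by rewrite /sqd !mxE; field.
by rewrite mulf_eq0 subr_eq0 (negPf D0) (negPf DE).
Qed.

(** Heron's formula; the sign of the right-hand side gives the triangle
    inequality below. *)
Lemma heron X K L :
  4 * sqd X K * sqd X L - (sqd K L - sqd X K - sqd X L) ^+ 2
  = (2 * area2 X K L) ^+ 2.
Proof. by rewrite /sqd /area2; ring. Qed.

Lemma edist_sqr A B : edist A B ^+ 2 = sqd A B.
Proof. by rewrite edistE sqr_sqrtr ?sqd_ge0. Qed.

Lemma edist_ge0 A B : 0 <= edist A B.
Proof. by rewrite edistE sqrtr_ge0. Qed.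

Lemma edist_triangle X K L :
  `|edist X K - edist X L| <= edist K L <= edist X K + edist X L.
Proof.
have hp := edist_ge0 X K; have hq := edist_ge0 X L; have hc := edist_ge0 K L.
have := heron X K L; rewrite -!edist_sqr.
move: (edist X K) (edist X L) (edist K L) hp hq hc => p q c hp hq hc h.
have {h} : `|c ^+ 2 - p ^+ 2 - q ^+ 2| <= 2 * (p * q).
  rewrite -ler_sqr ?nnegrE ?normr_ge0 ?mulr_ge0 // real_normK ?num_real //.
  have := sqr_ge0 (2 * area2 X K L); rewrite -h; lra.
rewrite ler_norml => /andP[h1 h2]; apply/andP; split.
  by rewrite -ler_sqr ?nnegrE ?normr_ge0 // real_normK ?num_real //; lra.
by rewrite -ler_sqr ?nnegrE ?addr_ge0 //; lra.
Qed.

(** The squared equation is the product of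
    [(|XK| + |XL| - 2a)(| |XK| - |XL| | - 2a)] and factors that do not vanish for
    [a <> 0].  The triangle inequality decides which of the two factors can
    vanish: the first if [2a > |KL|], the second if [2a < |KL|]. *)
Lemma focal_conic_foci K L D : 0 <= D -> D != sqd K L ->
  conic_with_foci (focal_conic K L D) K L.
Proof.
move=> D0 DE; split; first exact: focal_conic_is_conic.
have hD := sqr_sqrtr D0; have ht := sqrtr_ge0 D.
move: (Num.sqrt D) hD ht => t hD ht.
exists (t / 2); split; first by rewrite divr_ge0.
rewrite mulrC divfK ?pnatr_eq0 //.
have locus X : affine_locus (focal_conic K L D) X <->
    (t - (edist X K + edist X L)) * (`|edist X K - edist X L| - t) = 0.
  rewrite /affine_locus /=; have hp := edist_ge0 X K; have hq := edist_ge0 X L.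
  have [t0|t0] := eqVneq t 0.
    rewrite -hD t0 expr0n focal_conic0E -!edist_sqr.
    move: hp hq; set p := edist X K; set q := edist X L => hp hq; split=> h.
      have /eqP : (p + q) * (p - q) = 0 by lra.
      by rewrite mulf_eq0 => /orP[]/eqP ->; rewrite ?normr0; ring.
    have : (p + q) * `|p - q| = 0 by lra.
    move/eqP; rewrite mulf_eq0 normr_eq0 => h'.
    have : (p + q) * (p - q) = 0 by apply/eqP; rewrite mulf_eq0.
    lra.
  have D1 : D != 0 by rewrite -hD sqrf_eq0.
  have := focal_conicE K L X D1; rewrite -!edist_sqr.
  move: hp hq; set p := edist X K; set q := edist X L => hp hq hX.
  have {hX} : 4 * qform (focal_conic K L D) (homog X) (homog X) =
    ((t - (p + q)) * (`|p - q| - t)) * - ((t + (p + q)) * (`|p - q| + t)).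
    rewrite hX -hD.
    transitivity (((t - (p + q)) * (t + (p + q)))
                  * - (`|p - q| ^+ 2 - t ^+ 2)); last ring.
    by rewrite real_normK ?num_real //; ring.
  move=> hX; split=> [h|h]; last by move: hX; rewrite h mul0r; lra.
  have tp : 0 < t by rewrite lt_def t0.
  have s1 : 0 < t + (p + q) by rewrite ltr_pwDl ?addr_ge0.
  have s2 : 0 < `|p - q| + t by rewrite ltr_wpDl.
  move/esym/eqP: hX; rewrite h mulr0 mulf_eq0 oppr_eq0 => /orP[/eqP //|].
  by rewrite gt_eqF ?mulr_gt0.
have tc : t != edist K L.
  by apply: contraNneq DE => tc; rewrite -hD tc edist_sqr.
case: (ltgtP t (edist K L)) tc => // tc _; [right|left]; split=> //;
  apply/predeqP => X; rewrite locus /=; have /andP[h1 h2] := edist_triangle X K L.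
  split=> [/eqP|->]; last by rewrite subrr mulr0.
  rewrite mulf_eq0 => /orP[/eqP h|]; first by exfalso; lra.
  by rewrite subr_eq0 => /eqP.
split=> [/eqP|->]; last by rewrite subrr mul0r.
rewrite mulf_eq0 => /orP[|/eqP h]; last by exfalso; lra.
by rewrite subr_eq0 => /eqP.
Qed.

(** The bisector of [PQ] touches the conic whose axis is the distance from [L] to
    the mirror image of [K]: by [sqd_mirror] the product of the distances of the
    foci to the bisector is the one that characterizes tangents. *)
Lemma mirror_tangent K L P Q A B (D := sqd (mirror P Q K) L) :
  P != Q -> A != B -> sqd A P = sqd A Q -> sqd B P = sqd B Q ->
  D != sqd K L -> line_tangent_to_conic (focal_conic K L D) A B.
Proof.
move=> PQ AB hA hB DE; split; first exact/eqP.
have [D0|D0] := eqVneq D 0.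
  (* The mirror is the bisector of [KL], so it is the conic itself. *)
  have mL : mirror P Q K = L by apply/eqP; rewrite -sqd_eq0 -/D D0.
  have hAK : sqd A K = sqd A L by rewrite -(sqd_mirror_equidistant K PQ) ?mL.
  have hBK : sqd B K = sqd B L by rewrite -(sqd_mirror_equidistant K PQ) ?mL.
  rewrite D0; exists (homog A); rewrite !focal_conic0E hAK hBK; split; [|lra|lra|lra].
  rewrite homogE /focal_conic eqxx row3_sym3; apply/eqP/row3_neq0.
  rewrite !mulr0 !mul1r !add0r !subr_eq0.
  move: DE; rewrite D0 eq_sym sqd_eq0 => KL.
  apply: contraNT KL; rewrite !negb_or !negbK => /and3P[/eqP e1 /eqP e2 _].
  by rewrite -sqd_eq0 /sqd e1 e2 !subrr expr0n addr0.
have := sqd_mirror K L PQ; rewrite -/D.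
move: D DE D0 => D DE D0 hD.
pose ex := px L - px K; pose ey := py L - py K.
pose mx := (px K + px L) / 2; pose my := (py K + py L) / 2.
pose u1 := px Q - px P; pose u2 := py Q - py P.
pose w := (px Q ^+ 2 + py Q ^+ 2 - px P ^+ 2 - py P ^+ 2) / 2.
pose c := D * (D - sqd K L).
have c0 : c != 0 by rewrite mulf_neq0 ?subr_eq0.
(* [v] is the pole of the line [u1 x + u2 y = w]: its coefficient row times the
   inverse matrix of the conic, rescaled by [c].  It is at infinity if [v3 = 0],
   when the line passes through the center and so is an asymptote. *)
pose v3 := - 4 * (w - u1 * mx - u2 * my).
pose v1 := - (ex * u1 + ey * u2) * ex - (D - sqd K L) * u1 + mx * v3.
pose v2 := - (ex * u1 + ey * u2) * ey - (D - sqd K L) * u2 + my * v3.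
have vM : row3 v1 v2 v3 *m focal_conic K L D = row3 (c * u1) (c * u2) (- (c * w)).
  rewrite /focal_conic (negPf D0) row3_sym3 /v1 /v2 /v3 /c /w /u1 /u2.
  rewrite /mx /my /ex /ey /sqd.
  by congr row3; field.
have on_line X : sqd X P = sqd X Q -> u1 * px X + u2 * py X = w.
  by rewrite /sqd /u1 /u2 /w => h; lra.
exists (row3 v1 v2 v3); rewrite /qform vM !homogE !row3_dot; split.
- apply/eqP/row3_neq0; rewrite !(mulf_eq0 c) !(negPf c0) /= !subr_eq0.
  apply: contraNT PQ; rewrite !negb_or !negbK => /and3P[/eqP e1 /eqP e2 _].
  by rewrite -sqd_eq0 /sqd e1 e2 !subrr expr0n addr0.
(* The pole is on its own polar line: this is the tangency condition. *)
- transitivity (c * ((sqd K P - sqd K Q) * (sqd L P - sqd L Q)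
                     - (D - sqd K L) * sqd P Q)).
    by rewrite /v1 /v2 /v3 /w /u1 /u2 /mx /my /ex /ey /sqd; field.
  by rewrite hD subrr mulr0.
- by rewrite -(on_line A hA); ring.
- by rewrite -(on_line B hB); ring.
Qed.

(** * The closed chain *)

Lemma circumcenter_sqd O A B C D : is_circumcenter O A B C D ->
  [/\ sqd A O = sqd B O, sqd A O = sqd C O & sqd A O = sqd D O].
Proof.
move=> [r [r0 h]].
have on X : [set A; B; C; D]%classic X -> sqd X O = r ^+ 2.
  by move=> /h /(circle_sqd O X r0).
by rewrite !on //=; [right|left; right|left; left; right|left; left; left].
Qed.

Lemma circle_eq K L r s : 0 < r -> 0 < s ->
  (forall X, sqd X K - r ^+ 2 = sqd X L - s ^+ 2) -> circle K r = circle L s.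
Proof.
move=> r0 s0 h; apply/predeqP => X; rewrite !circle_sqd //.
by have := h X; split; lra.
Qed.
End Plane.

Lemma ordS_neq n (i : 'I_n) : (1 < n)%N -> ordS i != i.
Proof.
move=> n1; rewrite -val_eqE /=; have := ltn_ord i; rewrite leq_eqVlt.
move=> /orP[/eqP e|h]; last by rewrite modn_small // gtn_eqF.
by rewrite {1}e modnn; case: (nat_of_ord i) e => // e; rewrite -e in n1.
Qed.

Lemma ordS2_neq n (i : 'I_n) : (2 < n)%N -> ordS (ordS i) != i.
Proof.
move=> n2; rewrite -val_eqE /=; have := ltn_ord i; rewrite leq_eqVlt.
move=> /orP[/eqP e|h].
  rewrite e modnn modn_small ?(ltn_trans _ n2) //.
  by case: (nat_of_ord i) e => [|[|k]] // e; rewrite -e in n2.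
rewrite (modn_small h); move: h; rewrite leq_eqVlt => /orP[/eqP e|h].
  by rewrite e modnn; case: (nat_of_ord i) e => // e; rewrite -e in n2.
by rewrite modn_small // -addn2 -[X in _ != X]addn0 eqn_add2l.
Qed.

Lemma ordS_invariant (T : Type) n (f : 'I_n -> T) :
  (forall i, f (ordS i) = f i) -> forall i j, f i = f j.
Proof.
case: n f => [|n] f hf; first by case.
suff h i : f i = f ord0 by move=> i j; rewrite !h.
case: i => k; elim: k => [|k IH] hk; first by congr f; apply: val_inj.
rewrite -(IH (ltnW hk)) -[RHS]hf; congr f; apply: val_inj => /=.
by rewrite modn_small.
Qed.

(** If [P_i] is on [c(L)], then [c(O_i)] meets [c(L)] in [P_i], [Q_i] and
    [Q_(i+1)], so it equals [c(L)] and [P_(i+1)] is on [c(L)] as well.  Repeating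
    this yields three common points of [c(K)] and [c(L)].  The roles of [P] and
    [Q] can be exchanged. *)
Lemma no_common_vertex (R : realType) (K L : 'rV[R]_2) (r s : R) n
    (P Q O : 'I_n -> 'rV[R]_2) :
  0 < r -> 0 < s -> circle K r <> circle L s -> (2 < n)%N -> injective P ->
  (forall i, sqd (P i) K = r ^+ 2) -> (forall i, sqd (Q i) L = s ^+ 2) ->
  (forall i, [/\ P i != Q i, Q i != Q (ordS i) & Q (ordS i) != P i]) ->
  (forall i, [/\ sqd (P i) (O i) = sqd (Q i) (O i),
     sqd (P i) (O i) = sqd (Q (ordS i)) (O i) &
     sqd (P i) (O i) = sqd (P (ordS i)) (O i)]) ->
  forall i, sqd (P i) L != s ^+ 2.
Proof.
move=> r0 s0 KL n2 Pinj hP hQ dist hO i; apply/eqP => hi.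
have step j : sqd (P j) L = s ^+ 2 -> sqd (P (ordS j)) L = s ^+ 2.
  move=> hj; have [d1 d2 d3] := dist j; have [o1 o2 o3] := hO j.
  have := @three_common_points _ L (O j) _ _ _ (P (ordS j)) d1 d2 d3.
  rewrite !hQ hj => /(_ erefl erefl o1 o2); rewrite -o3 subrr.
  by move/eqP; rewrite subr_eq0 => /eqP.
have hi1 := step _ hi; have hi2 := step _ hi1.
apply: KL; apply: circle_eq => // X.
rewrite -(hP i) -hi;
      apply: (three_common_points (B := P (ordS i)) (C := P (ordS (ordS i))));
  rewrite ?hP ?hi ?hi1 ?hi2 // (inj_eq Pinj).
- by rewrite eq_sym ordS_neq // ltnW.
- by rewrite eq_sym ordS_neq // ltnW.
- exact: ordS2_neq.
Qed.

Theorem theorem2 (R : realType) (K L : 'rV[R]_2) (r s : R)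
  (hr : 0 < r) (hs : 0 < s) (hKL : circle K r <> circle L s)
  (n : nat) (hn : (2 < n)%N) (hev : ~~ odd n)
  (P Q : 'I_n -> 'rV[R]_2)
  (hP : forall i, circle K r (P i)) (hQ : forall i, circle L s (Q i))
  (hPinj : injective P) (hQinj : injective Q)
  (hcyc : forall i, cyclic4 (P i) (Q i) (Q (ordS i)) (P (ordS i)))
  (O : 'I_n -> 'rV[R]_2)
  (hO : forall i, is_circumcenter (O i) (P i) (Q i) (Q (ordS i)) (P (ordS i))) :
  exists M : 'M[R]_3, conic_with_foci M K L /\
    forall i : 'I_n, line_tangent_to_conic M (O i) (O (ordS i)).
Proof.
have pK i : sqd (P i) K = r ^+ 2 by apply/circle_sqd.
have qL i : sqd (Q i) L = s ^+ 2 by apply/circle_sqd.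
have eqO i := circumcenter_sqd (hO i).
have neq i : [/\ P i != Q i, P i != Q (ordS i), P i != P (ordS i),
    Q i != Q (ordS i) & Q i != P (ordS i)].
  have [] := hcyc i; rewrite /= !inE !negb_or.
  by move=> /and4P[/and3P[a b c] /andP[d e] f _] _.
have pL : forall i, sqd (P i) L != s ^+ 2.
  apply: (no_common_vertex (O := O) hr hs hKL hn hPinj pK qL) => i.
    by have [a b c d e] := neq i; rewrite a d eq_sym b.
  exact: eqO.
have qK : forall i, sqd (Q i) K != r ^+ 2.
  apply: (no_common_vertex (O := O) hs hr (nesym hKL) hn hQinj qL pK) => i.
    by have [a b c d e] := neq i; rewrite eq_sym a c eq_sym e.
  by have [a b c] := eqO i; rewrite -a -b -c.
pose D i := sqd (mirror (P i) (Q i) K) L.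
have Dconst : forall i j, D i = D j.
  apply: ordS_invariant => i; apply/esym; rewrite /D.
  have [PQ _ PP QQ _] := neq i; have [PQ' _ _ _ _] := neq (ordS i).
  have [a b c] := eqO i.
  by apply: (@mirror_focus_invariant _ _ _ (O i)); rewrite ?pK ?qL.
pose i0 := Ordinal (ltn_trans (isT : 0 < 2)%N hn).
(* [2a <> |KL|], since no power vanishes. *)
have DE : D i0 != sqd K L.
  have [PQ _ _ _ _] := neq i0.
  rewrite -subr_eq0; apply: contraTneq isT => h.
  have /esym/eqP := sqd_mirror K L PQ; rewrite -/(D i0) h mul0r.
  rewrite !(sqdC K) !(sqdC L) pK qL mulf_eq0 !subr_eq0.
  by rewrite eq_sym (negPf (qK _)) (negPf (pL _)).
exists (focal_conic K L (D i0)); split.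
  exact: focal_conic_foci (sqd_ge0 _ _) DE.
move=> i; have [PQ _ _ _ _] := neq (ordS i).
have [a b c] := eqO i; have [a' b' c'] := eqO (ordS i).
rewrite (Dconst i0 (ordS i)); apply: mirror_tangent => //.
(* If [O_i = O_(i+1)], the circle around it equals both [c(K)] and [c(L)]. *)
- apply/eqP => OO; apply: hKL; apply: circle_eq => // X.
  have i1 : i != ordS i by rewrite eq_sym ordS_neq // ltnW.
  have i2 : ordS i != ordS (ordS i) by rewrite eq_sym ordS_neq // ltnW.
  have i3 : ordS (ordS i) != i by apply: ordS2_neq.
  rewrite -OO in a' b' c'.
  have -> : sqd X K - r ^+ 2 = sqd X (O i) - sqd (P i) (O i).
    rewrite -(pK i);
      apply: (three_common_points (B := P (ordS i)) (C := P (ordS (ordS i))));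
      by rewrite ?(inj_eq hPinj) ?pK // c.
  have -> : sqd X L - s ^+ 2 = sqd X (O i) - sqd (Q i) (O i).
    rewrite -(qL i);
      apply: (three_common_points (B := Q (ordS i)) (C := Q (ordS (ordS i))));
      by rewrite ?(inj_eq hQinj) ?qL // -a b // -b' -a'.
  by rewrite a.
- by rewrite !(sqdC (O i)) -c -b.
- by rewrite !(sqdC (O (ordS i))) a'.
- by rewrite -/(D (ordS i)) (Dconst (ordS i) i0).
Qed.
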